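(* Let $\mathcal H$ be a real Hilbert space, let $\Phi:\mathcal H\to\mathbb{R}\cup\{+\infty\}$ be a convex lower semicontinuous proper function, let $B:\mathcal H\to\mathcal H$ be a $\beta$-cocoercive operator for some $\beta>0$, and let $\lambda>0$. Suppose that $S=\{z\in\mathcal H:\ \partial\Phi(z)+Bz\ni 0\}$ is nonempty. Let $(x_0,v_0)\in\mathcal H\times\mathcal H$ with $v_0\in\partial\Phi(x_0)$, and let $(x(\cdot),v(\cdot)):[0,+\infty[\,\to\mathcal H\times\mathcal H$ be the strong global solution of $$v(t)\in\partial\Phi(x(t)),\qquad \lambda\dot x(t)+\dot v(t)+v(t)+B(x(t))=0,\qquad x(0)=x_0,\ v(0)=v_0 .$$ Then, as $t\to+\infty$: 1. $\lim_{t\to+\infty}\|v(t)+B(x(t))\|=0$; 2. $B(x(t))$ converges strongly to $Bz$, where $Bz$ is uniquely defined for $z\in S$ (i.e. it is the same vector for all $z\in S$); 3. $v(t)$ converges strongly to $-Bz$, where $Bz$ is uniquely defined for $z\in S$; 4. $x(t)$ converges weakly to an element of $S$.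
   Context: $\partial\Phi$ denotes the convex subdifferential. $B:\mathcal H\to\mathcal H$ is $\beta$-cocoercive if $\langle Bx-By,x-y\rangle\ge\beta\|Bx-By\|^2$ for all $x,y\in\mathcal H$. A strong global solution of the system is a pair $(x(\cdot),v(\cdot)):[0,+\infty[\,\to\mathcal H\times\mathcal H$ such that: $x$ and $v$ are absolutely continuous on each interval $[0,b]$, $0<b<+\infty$; $v(t)\in\partial\Phi(x(t))$ for all $t\ge 0$; $\lambda\dot x(t)+\dot v(t)+v(t)+B(x(t))=0$ for almost all $t\ge0$; $x(0)=x_0$, $v(0)=v_0$. *)

(* Defs.v *)
From HB Require Import structures.
From mathcomp Require Import all_boot all_order all_algebra.
From mathcomp Require Import all_classical all_reals all_analysis.

Set Implicit Arguments.
Unset Strict Implicit.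
Unset Printing Implicit Defensive.

Import Order.TTheory GRing.Theory Num.Theory.
Import numFieldNormedType.Exports.

Local Open Scope classical_set_scope.
Local Open Scope ring_scope.

(* A real Hilbert space is a [H : completeNormedModType R] together with a
   positive definite symmetric bilinear form [ip : {dot H for idfun}] that
   induces the norm. *)
Definition induces_norm (R : realType) (H : completeNormedModType R)
    (ip : {dot H for idfun}) : Prop :=
  forall u : H, ip u u = `|u| ^+ 2.

Definition proper_function (R : realType) (H : completeNormedModType R)
    (Phi : H -> \bar R) : Prop :=
  (forall u : H, Phi u != -oo%E) /\ (exists u : H, Phi u != +oo%E).

(* Meant for functions that avoid [-oo], so that the right-hand side is never
   of the form +oo - oo. *)
Definition econvex (R : realType) (H : completeNormedModType R)
    (Phi : H -> \bar R) : Prop :=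
  forall (u w : H) (s : R), 0 < s -> s < 1 ->
    (Phi (s *: u + (1 - s) *: w)%R
       <= s%:E * Phi u + (1 - s)%R%:E * Phi w)%E.

(* For a proper [Phi] this set is empty at every point where [Phi] is [+oo]. *)
Definition subdifferential (R : realType) (H : completeNormedModType R)
    (ip : {dot H for idfun}) (Phi : H -> \bar R) (u : H) : set H :=
  [set p : H | forall w : H, (Phi u + (ip p (w - u))%:E <= Phi w)%E].

Definition cocoercive (R : realType) (H : completeNormedModType R)
    (ip : {dot H for idfun}) (beta : R) (B : H -> H) : Prop :=
  forall u w : H, beta * `|B u - B w| ^+ 2 <= ip (B u - B w) (u - w).

Definition zeros (R : realType) (H : completeNormedModType R)
    (ip : {dot H for idfun}) (Phi : H -> \bar R) (B : H -> H) : set H :=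
  [set z : H | [set p + B z | p in subdifferential ip Phi z] 0].

(* The intervals ]a i, b i[ are pairwise non-overlapping subintervals of
   [c, d]. *)
Definition absolutely_continuous (R : realType) (H : completeNormedModType R)
    (c d : R) (f : R -> H) : Prop :=
  forall eps : R, 0 < eps -> exists2 delta : R, 0 < delta &
    forall (n : nat) (a b : 'I_n -> R),
      (forall i, [/\ c <= a i, a i <= b i & b i <= d]) ->
      (forall i j, i != j -> b i <= a j \/ b j <= a i) ->
      \sum_(i < n) (b i - a i) < delta ->
      \sum_(i < n) `|f (b i) - f (a i)| < eps.

(* Trajectories are total functions on [R] of which only the values on
   [0, +oo[ matter: the derivatives at [t > 0] are local, and [t = 0] is
   negligible.  Differentiability is stated next to the differential equation
   because [derive1] is a total operator, with an arbitrary value where [x] is not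
   differentiable. *)
Record strong_global_solution (R : realType) (H : completeNormedModType R)
    (ip : {dot H for idfun}) (Phi : H -> \bar R) (B : H -> H) (lambda : R)
    (x0 v0 : H) (x v : R -> H) : Prop := StrongGlobalSolution {
  solution_acx : forall b : R, 0 < b -> absolutely_continuous 0 b x;
  solution_acv : forall b : R, 0 < b -> absolutely_continuous 0 b v;
  solution_subdiff : forall t : R, 0 <= t -> subdifferential ip Phi (x t) (v t);
  solution_ode : {ae @lebesgue_measure R, forall t : R, 0 <= t ->
    [/\ derivable x t 1, derivable v t 1 &
        lambda *: derive1 x t + derive1 v t + v t + B (x t) = 0]};
  solution_x0 : x 0 = x0;
  solution_v0 : v 0 = v0
}.

Definition weakly_converges (R : realType) (H : completeNormedModType R)
    (ip : {dot H for idfun}) (x : R -> H) (l : H) : Prop :=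
  forall y : H, ip (x t) y @[t --> +oo] --> ip l y.

(* Main.v *)
(* For a zero [z] put [u = v + B z], [b = B x - B z], and consider the Bregman
   distance [G = Phi x - Phi z + <B z, x - z>] and the energy
   [E = lambda/2 |x - z|^2 + (Phi z - Phi x - <v, z - x>)].  With
   [<x', v'> >= 0] the equation gives, almost everywhere,
     [E' <= - beta |b|^2],
     [G' <= - lambda/2 |x'|^2 + |b|^2 / (2 lambda)],
     [(|u|^2 / 2)' <= - |u|^2 / 2 + lambda^2 |x'|^2 + |b|^2].
   Suitable positive combinations are nonincreasing, so [E], [G] and [|u|]
   converge, and the limit of [|u|] can only be 0.  Since [x] becomes uniformly
   slow and [b] is Lipschitz in [x], [E' <= - beta |b|^2] forces [b -> 0].  Then
   [|x - z|] converges for every zero [z], and Opial's argument gives the weak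
   limit.

   Lebesgue integrals are avoided: differential inequalities are integrated by
   the monotonicity of absolutely continuous functions with a nonnegative
   derivative almost everywhere.  Weak compactness is avoided by the asymptotic
   center of [x] along a filter, i.e. the minimizer of
   [y |-> limsup |x t - y|^2], which belongs to every closed convex set that
   eventually contains [x]. *)

Require Import Defs.
From HB Require Import structures.
From mathcomp Require Import all_boot all_order all_algebra.
From mathcomp Require Import all_classical all_reals all_analysis measurable_realfun.
From mathcomp Require Import ring lra.

Import Order.TTheory GRing.Theory Num.Theory.
Import numFieldNormedType.Exports.

Set Implicit Arguments.
Unset Strict Implicit.
Unset Printing Implicit Defensive.

Local Open Scope classical_set_scope.
Local Open Scope ring_scope.

Lemma normr_le_sqr {R : realDomainType} (p c : R) :
  0 <= c -> p ^+ 2 <= c ^+ 2 -> `|p| <= c.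
Proof.
by move=> c0 pc; rewrite ler_norml; apply/andP; split; nra.
Qed.

(** * Inner products *)

Section InnerProduct.
Context {R : realType} {H : completeNormedModType R} (ip : {dot H for idfun}).

Definition inner (u w : H) : R := ip u w.

Lemma innerC u w : inner u w = inner w u.
Proof. by rewrite /inner (hermC ip) expr0 mul1r. Qed.

Lemma innerDl u u' w : inner (u + u') w = inner u w + inner u' w.
Proof. exact: linearDl. Qed.

Lemma innerNl u w : inner (- u) w = - inner u w.
Proof. exact: linearNl. Qed.

Lemma innerZl (a : R) u w : inner (a *: u) w = a * inner u w.
Proof. by rewrite /inner linearZl_LR. Qed.

Lemma innerDr w u u' : inner w (u + u') = inner w u + inner w u'.
Proof. exact: linearD. Qed.

Lemma innerNr w u : inner w (- u) = - inner w u.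
Proof. exact: linearN. Qed.

Lemma innerZr (a : R) w u : inner w (a *: u) = a * inner w u.
Proof. by rewrite /inner linearZ. Qed.

Lemma inner0l w : inner 0 w = 0.
Proof. exact: linear0l. Qed.

Lemma inner0r w : inner w 0 = 0.
Proof. exact: linear0. Qed.

Definition innerE := (innerDl, innerDr, innerNl, innerNr,
  innerZl, innerZr, inner0l, inner0r).

Hypothesis ip_norm : induces_norm ip.

Lemma inner_norm u : inner u u = `|u| ^+ 2.
Proof. exact: ip_norm. Qed.

Lemma cauchy_schwarz u w : `|inner u w| <= `|u| * `|w|.
Proof.
have [->|w0] := eqVneq w 0; first by rewrite inner0r !normr0 mulr0.
have nw : 0 < `|w| by rewrite normr_gt0.
(* This vector is [|w|^2] times the component of [u] orthogonal to [w]. *)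
have : 0 <= inner (`|w| ^+ 2 *: u - inner u w *: w) (`|w| ^+ 2 *: u - inner u w *: w).
  by rewrite inner_norm sqr_ge0.
rewrite !innerE (innerC w u) !inner_norm.
set p := inner u w; set a := `|u|; set c := `|w|.
move=> h.
have : 0 <= c ^+ 2 * ((a * c) ^+ 2 - p ^+ 2) by lra.
rewrite pmulr_rge0 ?exprn_gt0// subr_ge0 => {}h.
apply: normr_le_sqr h; apply: mulr_ge0; exact: normr_ge0.
Qed.

Lemma inner_le u w : inner u w <= `|u| * `|w|.
Proof. exact: le_trans (ler_norm _) (cauchy_schwarz u w). Qed.

Lemma cvg_inner {T : Type} {F : set_system T} {FF : Filter F} (f g : T -> H) a b :
  f @ F --> a -> g @ F --> b -> inner (f t) (g t) @[t --> F] --> inner a b.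
Proof.
move=> fa gb; apply/cvgrPdist_le => e e0 /=; near=> t.
have -> : inner a b - inner (f t) (g t) = inner (a - f t) b + inner (f t) (b - g t).
  by rewrite !innerE; ring.
apply: le_trans (ler_normD _ _) _.
apply: le_trans (lerD (cauchy_schwarz _ _) (cauchy_schwarz _ _)) _.
have fM : `|f t| <= `|a| + 1.
  rewrite -[f t](subrKC a) (le_trans (ler_normD _ _))// lerD2l distrC.
  by near: t; move/cvgrPdist_le : fa; apply.
have h1 : `|a - f t| <= e / 2 / (`|b| + 1).
  near: t; move/cvgrPdist_le : fa; apply.
  by rewrite !divr_gt0// ltr_wpDl.
have h2 : `|b - g t| <= e / 2 / (`|a| + 1).
  near: t; move/cvgrPdist_le : gb; apply.
  by rewrite !divr_gt0// ltr_wpDl.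
rewrite (splitr e) lerD//.
  rewrite (le_trans (ler_wpM2r _ h1))// mulrAC ler_pdivrMr ?ltr_wpDl//.
  by rewrite ler_wpM2l ?lerDl// divr_ge0// ltW.
rewrite (le_trans (ler_pM _ _ fM h2))// mulrC divfK// gt_eqF// ltr_wpDl//.
Unshelve. all: by end_near. Qed.

End InnerProduct.

(** * Absolutely continuous functions *)

(** The supremum of the points satisfying [Q] must be [d], since a step across it would otherwise go
    beyond it. Steps run from the left of [s] to its right because [Q] is only known at points
    approaching the supremum. *)
Lemma real_induction {R : realType} (c d : R) (Q : R -> Prop) : c <= d -> Q c ->
  (forall s, c <= s <= d -> exists2 r, 0 < r &
    forall t u, c <= t -> t <= s -> s <= u -> u <= d -> s - r < t -> u < s + r ->
      Q t -> Q u) ->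
  Q d.
Proof.
move=> cd Qc step; set S := [set t | c <= t <= d /\ Q t].
have Sc : S c by split=> //; rewrite lexx.
have Sub : ubound S d by move=> t [/andP[]].
have Ssup : has_sup S by split; [exists c|exists d].
have cS : c <= sup S by apply: ub_le_sup Sc; exists d.
have Sd : sup S <= d by apply: ge_sup => //; exists c.
have [|r r0 {}step] := step (sup S); first by rewrite cS Sd.
have [t [/andP[ct td] Qt] rt] := sup_adherent r0 Ssup.
have tS : t <= sup S by apply: ub_le_sup => //; [exists d|split=> //; rewrite ct].
have Qu : Q (Num.min d (sup S + r / 2)).
  apply: (step t) => //; first by rewrite le_min Sd; lra.
    by rewrite ge_min lexx.
  by rewrite gt_min; apply/orP; right; lra.
have : Num.min d (sup S + r / 2) <= sup S.
  apply: ub_le_sup; first by exists d.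
  split=> //; rewrite ge_min lexx andbT le_min cd /=; lra.
have [?|?] := leP d (sup S + r / 2) => // h; last lra.
by move: Qu; rewrite min_l.
Qed.

Section AbsolutelyContinuousReal.
Context {R : realType}.
Implicit Types (f : R -> R) (c d : R).

(* In the application, the first alternative holds at points of
   differentiability and the second one on an exceptional null set: the
   intervals used there have total length at most [phi d - phi c], and absolute
   continuity bounds the variation of [f] over them. *)
Lemma ac_covering f c d (e e' : R) : c <= d -> 0 <= e ->
  absolutely_continuous c d (f : R -> R^o) -> 0 < e' ->
  exists2 delta, 0 < delta & 
  forall phi : R -> R, {homo phi : t u / t <= u} -> phi d - phi c < delta ->
  (forall s, c <= s <= d -> exists2 r, 0 < r & 
     (forall t u, c <= t -> t <= s -> s <= u -> u <= d -> s - r < t -> u < s + r ->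
        - (e * (u - t)) <= f u - f t) \/
     (forall t u, c <= t -> t <= s -> s <= u -> u <= d -> s - r < t -> u < s + r ->
        u - t <= phi u - phi t)) ->
  - (e * (d - c)) - e' <= f d - f c.
Proof.
move=> cd e0 acf e'0; have [delta delta0 dP] := acf _ e'0.
exists delta => // phi phi_homo phi_d loc.
(* [Q t] keeps a list of non-overlapping intervals in [[c, t]] of total length at most
   [phi t - phi c]; off these intervals [f] loses at most [e] per unit of length. *)
pose Q t := exists n (a b : nat -> R), 
  [/\ forall i, (i < n)%N -> [/\ c <= a i, a i <= b i & b i <= t],
      forall i j, (i < n)%N -> (j < n)%N -> i != j -> b i <= a j \/ b j <= a i,
      \sum_(i < n) (b i - a i) <= phi t - phi c &
      - (e * (t - c)) - \sum_(i < n) `|f (b i) - f (a i)| <= f t - f c].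
have [n [a [b [ab disj len inc]]]] : Q d.
  apply: (@real_induction R c d) => //.
    by exists 0%N, (fun=> 0), (fun=> 0); split => //; rewrite !big_ord0; lra.
  move=> s /loc[r r0 h]; exists r => // t u ct ts su ud rt ur.
  have tu : t <= u by exact: le_trans su.
  move=> [n [a [b [ab disj len inc]]]].
  case: h => /(_ _ _ ct ts su ud rt ur) h.
    exists n, a, b; split => //.
    - by move=> i /ab[? ? bt]; split => //; exact: le_trans tu.
    - by apply: le_trans len _; rewrite lerD2r phi_homo.
    - by move: inc h; set X := \sum_(_ < _) _; lra.
  (* In the second alternative [[t, u]] joins the list as its last interval, with index [n]. *)
  exists n.+1, (fun i => if (i < n)%N then a i else t),
    (fun i => if (i < n)%N then b i else u).
  split.
  - move=> i _; case: ifPn => // /ab[? ? bt]; split => //; exact: le_trans tu.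
  - move=> i j; rewrite !ltnS => i_n j_n ij.
    case: (ltnP i n) => i_lt; case: (ltnP j n) => j_lt; first exact: disj.
    - by left; have [] := ab _ i_lt.
    - by right; have [] := ab _ j_lt.
    - suff : i = j by move/eqP; rewrite (negPf ij).
      by apply/eqP; rewrite eqn_leq (leq_trans i_n j_lt) (leq_trans j_n i_lt).
  - rewrite big_ord_recr /= ltnn; under eq_bigr do rewrite ltn_ord.
    by move: len h; set X := \sum_(_ < _) _; lra.
  - rewrite big_ord_recr /= ltnn; under eq_bigr do rewrite ltn_ord.
    have := ler_norm (- (f u - f t)).
    rewrite normrN; move: inc; set X := \sum_(_ < _) _.
    have : 0 <= e * (u - t) by apply: mulr_ge0 => //; lra.
    lra.
suff : \sum_(i < n) `|f (b i) - f (a i)| < e' by move: inc; set X := \sum_(_ < _) _; lra.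
apply: (dP n a b) => [i|i j ij|]; first exact: ab.
  exact: disj.
exact: le_lt_trans len phi_d.
Qed.


End AbsolutelyContinuousReal.

(** * Monotonicity from the sign of the derivative almost everywhere *)

Section Monotonicity.
Context {R : realType}.
Implicit Types (f : R -> R) (c d : R).
Notation mu := (@lebesgue_measure R).

(** Outer regularity gives an open [G] of measure below [delta] that contains [N], and [phi t] is
    the measure of [G] to the left of [t]. Around a point of [N] a whole interval lies in [G], where
    [phi] grows with slope 1. *)
Lemma null_set_gauge (N : set R) (delta : R) : mu.-negligible N -> 0 < delta ->
  exists phi : R -> R, [/\ {homo phi : t u / t <= u},
    forall t u, phi u - phi t < delta &
    forall s, N s -> exists2 r, 0 < r & forall t u, t <= s -> s <= u ->
      s - r < t -> u < s + r -> u - t <= phi u - phi t].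
Proof.
move=> [A [mA A0 NA]] delta0.
have A_fin : (mu A < +oo)%E by rewrite A0.
have [G [oG AG GA]] := lebesgue_regularity_outer mA A_fin delta0.
have mG : measurable G by exact: open_measurable.
have Gdelta : (mu G < delta%:E)%E.
  rewrite -(setDKU AG); apply: le_lt_trans GA.
  rewrite -[leRHS]adde0 -A0; apply: measureU2 => //; exact: measurableD.
have mGt t : measurable (G `&` `]-oo, t]) by exact: measurableI.
have fin t : mu (G `&` `]-oo, t]) \is a fin_num.
  rewrite ge0_fin_numE//; apply: le_lt_trans (lt_trans Gdelta (ltry _)).
  by apply: le_measure; rewrite ?inE; [exact: mGt|exact: mG|exact: subIsetl].
pose phi t := fine (mu (G `&` `]-oo, t])).
exists phi; split.
- move=> t u tu; apply: fine_le => //; apply: le_measure; rewrite ?inE; [exact: mGt|exact: mGt|].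
  by apply: setIS => r /=; rewrite !in_itv /= => /le_trans; apply.
- move=> t u; have : phi u < delta.
    rewrite -lte_fin /phi fineK//; apply: le_lt_trans Gdelta.
    by apply: le_measure; rewrite ?inE; [exact: mGt|exact: mG|exact: subIsetl].
  have : 0 <= phi t by exact: fine_ge0.
  lra.
- move=> s /NA/AG Gs.
  have /nbhs_ballP[r /= r0 rG] : nbhs s G by exact: open_nbhs_nbhs.
  exists r => // t u ts su rt ur.
  have tu := le_trans ts su.
  have sub : `]t, u] `<=` G.
    move=> y /=; rewrite in_itv /= => /andP[ty yu]; apply: rG => /=.
    by rewrite /ball /= ltr_norml; apply/andP; split; lra.
  rewrite -lee_fin !EFinB /phi !fineK//.
  have -> : mu (G `&` `]-oo, u]) = (mu (G `&` `]-oo, t]) + mu `]t, u])%E.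
    rewrite -measureU//; last 2 first.
    - exact: mGt.
    - rewrite -subset0 => y [[_]] /=; rewrite !in_itv /= => yt /andP[].
      by rewrite ltNge yt.
    congr (mu _); rewrite eqEsubset; split=> [y [Gy]|y [[Gy]|]] /=; rewrite !in_itv /=.
    - by move=> yu; case: (leP y t) => yt; [left|right; rewrite yu].
    - by move=> yt; split=> //; exact: le_trans tu.
    - by move=> /[dup] h /andP[_ ->]; split => //; apply: sub; rewrite /= in_itv.
  rewrite lebesgue_measure_itv /= lte_fin.
  case: ifPn => [_|]; first by rewrite addeAC subee// add0e.
  rewrite -leNgt => ut; rewrite adde0 subee//.
  have -> : u = t by apply/eqP; rewrite eq_le ut tu.
  by rewrite -EFinB subrr.
Qed.

(** The increment is split at [t]: on each side it differs from the linear one, which is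
    nonnegative, by at most [e] times the length. Intervals around [t] are the form that
    [ac_covering] asks for. *)
Lemma straddle f (t : R) (D : R) : is_derive t 1 f D -> 0 <= D ->
  forall e, 0 < e -> exists2 r, 0 < r &
    forall a b, a <= t -> t <= b -> t - r < a -> b < t + r -> - (e * (b - a)) <= f b - f a.
Proof.
move=> [df fD] D0 e e0.
move: df; rewrite /derivable -/(derive f t 1) fD => /cvgrPdist_le /(_ _ e0).
rewrite near_withinE => /nbhs_ballP[r /= r0 rP].
have h (k : R) : `|k| < r -> `|f (t + k) - f t - D * k| <= e * `|k|.
  move=> kr; have [->|k0] := eqVneq k 0.
    by rewrite addr0 subrr mulr0 subrr !normr0 mulr0.
  have := rP k; rewrite /ball /= sub0r normrN kr => /(_ isT k0).
  rewrite -(@ler_pM2r _ `|k|) ?normr_gt0//; apply: le_trans.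
  rewrite -normrM distrC mulrBl [k *: 1]mulr1 (addrC k).
  by rewrite [_ *: _ * k]mulrAC [k^-1 * k]mulVf// mul1r.
exists r => // a b at_ tb ra br.
have := h (b - t); have := h (a - t).
rewrite !subrKC !ler_norml !ltr_norml.
rewrite (ler0_norm (_ : a - t <= 0)) ?(ger0_norm (_ : 0 <= b - t)); try lra.
have -> : - r < a - t < r by apply/andP; split; lra.
have -> : - r < b - t < r by apply/andP; split; lra.
have : 0 <= D * (b - t) by apply: mulr_ge0 => //; lra.
have : 0 <= D * (t - a) by apply: mulr_ge0 => //; lra.
move=> ? ? /(_ isT)/andP[? ?] /(_ isT)/andP[? ?]; lra.
Qed.

(** Points with a nonnegative derivative are covered by [straddle], the others by the gauge of a
    null set; the two resulting errors [e] and [e'] are arbitrary. *)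
Lemma ac_nondecreasing f c d : c <= d -> absolutely_continuous c d (f : R -> R^o) ->
  {ae mu, forall t, c < t < d -> exists2 D : R, 0 <= D & is_derive t 1 f D} ->
  f c <= f d.
Proof.
move=> cd acf aef.
suff main e e' : 0 < e -> 0 < e' -> - (e * (d - c)) - e' <= f d - f c.
  rewrite -subr_ge0; apply/ler_addgt0Pr => e e0.
  have dc0 : 0 < d - c + 1 by lra.
  have := main (e / 2 / (d - c + 1)) (e / 2); rewrite !divr_gt0// => /(_ isT isT).
  suff : e / 2 / (d - c + 1) * (d - c) <= e / 2 by lra.
  by rewrite mulrAC ler_pdivrMr// ler_pM2l ?divr_gt0//; lra.
move=> e0 e'0.
have [delta delta0 dP] := ac_covering cd (ltW e0) acf e'0.
pose N := ~` [set t | c < t < d -> exists2 D : R, 0 <= D & is_derive t 1 f D].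
have N0 : mu.-negligible N by exact: aef.
(* The endpoints join the null set because the derivative is controlled only on the open
   interval. *)
have /null_set_gauge/(_ delta0)[phi [phi_homo phi_d phiN]] :
    mu.-negligible (N `|` [set c] `|` [set d]).
  apply: negligibleU; first apply: negligibleU => //.
    by apply/negligibleP => //; exact: lebesgue_measure_set1.
  by apply/negligibleP => //; exact: lebesgue_measure_set1.
apply: (dP phi) => // s /andP[cs sd].
have [/phiN[r r0 rP]|] := pselect ((N `|` [set c] `|` [set d]) s).
  by exists r => //; right => t u ct ts su ud; exact: rP.
move=> /not_orP[/not_orP[/contrapT Ns /eqP sc] /eqP sd'].
have /Ns[D D0 fD] : c < s < d by rewrite !lt_neqAle cs sd sd' eq_sym sc.
have [r r0 rP] := straddle fD D0 e0.
by exists r => //; left => t u ct ts su ud; exact: rP.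
Qed.
End Monotonicity.

(** * Closure properties of absolute continuity *)

Section AbsolutelyContinuous.
Context {R : realType}.
Implicit Types (c d : R).

Lemma ac_subitv {H : completeNormedModType R} (f : R -> H) c d c' d' :
  c <= c' -> d' <= d -> absolutely_continuous c d f -> absolutely_continuous c' d' f.
Proof.
move=> cc dd acf e /acf[delta delta0 dP]; exists delta => // n a b ab.
apply: dP => i; have [ca -> bd] := ab i.
by split=> //; [exact: le_trans ca|exact: le_trans dd].
Qed.

(** Sums, multiples, inner products and the potential along the trajectory all reduce to this
    comparison of increments. *)
Lemma ac_dominated {H1 H2 H : completeNormedModType R}
    (f1 : R -> H1) (f2 : R -> H2) (f : R -> H) (M c d : R) :
  absolutely_continuous c d f1 -> absolutely_continuous c d f2 ->
  (forall s t, c <= s -> s <= t -> t <= d ->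
    `|f t - f s| <= M * (`|f1 t - f1 s| + `|f2 t - f2 s|)) ->
  absolutely_continuous c d f.
Proof.
move=> ac1 ac2 fM e e0; set K := `|M| + 1.
have K0 : 0 < K by rewrite ltr_wpDl.
have eK : 0 < e / 2 / K by rewrite !divr_gt0.
have [d1 d10 dP1] := ac1 _ eK; have [d2 d20 dP2] := ac2 _ eK.
exists (Num.min d1 d2) => [|n a b ab disj]; first by rewrite lt_min d10.
rewrite lt_min => /andP[/(dP1 _ _ _ ab disj) h1 /(dP2 _ _ _ ab disj) h2].
have : K * \sum_(i < n) `|f1 (b i) - f1 (a i)| + K * \sum_(i < n) `|f2 (b i) - f2 (a i)| < e.
  by rewrite (splitr e) ltrD// mulrC -ltr_pdivlMr.
apply: le_lt_trans; rewrite -mulrDr -big_split mulr_sumr ler_sum//= => i _.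
have [? ? ?] := ab i; apply: le_trans (fM _ _ _ _ _) _ => //.
by rewrite ler_wpM2r ?addr_ge0// /K ler_wpDr// ler_norm.
Qed.

Lemma ac_uniform {H : completeNormedModType R} (f : R -> H) c d :
  absolutely_continuous c d f -> forall e : R, 0 < e -> exists2 delta : R, 0 < delta &
    forall s t, c <= s -> s <= t -> t <= d -> t - s < delta -> `|f t - f s| < e.
Proof.
move=> acf e /acf[delta delta0 dP]; exists delta => // s t cs st td tsd.
have := dP 1%N (fun=> s) (fun=> t); rewrite !big_ord1; apply => // i j.
by rewrite !ord1 eqxx.
Qed.

Lemma ac_bounded {H : completeNormedModType R} (f : R -> H) c d : c <= d ->
  absolutely_continuous c d f -> exists2 M : R, 0 <= M & forall t, c <= t <= d -> `|f t| <= M.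
Proof.
move=> cd /ac_uniform/(_ _ ltr01)[delta delta0 dP].
apply: (@real_induction R c d (fun t =>
  exists2 M : R, 0 <= M & forall s, c <= s <= t -> `|f s| <= M)) => //.
  by exists `|f c| => // t /le_anti ->.
move=> s /andP[cs sd]; exists (delta / 2); first by rewrite divr_gt0.
move=> t u ct ts su ud rt ur [M M0 fM].
exists (M + 1) => [|y /andP[cy yu]]; first by rewrite addr_ge0.
have [yt|ty] := leP y t.
  by rewrite (le_trans (fM _ _)) ?cy// lerDl.
have fyt : `|f y - f t| < 1.
  by apply: dP => //; [exact: ltW|exact: le_trans ud|lra].
rewrite -(subrKC (f t) (f y)) (le_trans (ler_normD _ _))// lerD ?fM ?ct ?lexx//.
exact: ltW.
Qed.

Lemma acD {H : completeNormedModType R} (f g : R -> H) c d :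
  absolutely_continuous c d f -> absolutely_continuous c d g ->
  absolutely_continuous c d (f \+ g).
Proof.
move=> acf acg; apply: (ac_dominated (M := 1) acf acg) => s t _ _ _ /=.
by rewrite mul1r opprD addrACA ler_normD.
Qed.

Lemma acZ {H : completeNormedModType R} (f : R -> H) k c d :
  absolutely_continuous c d f -> absolutely_continuous c d (fun t => k *: f t).
Proof.
move=> acf; apply: (ac_dominated (M := `|k|) acf acf) => s t _ _ _.
by rewrite -scalerBr normrZ ler_wpM2l// lerDl.
Qed.

Lemma ac_id c d : absolutely_continuous c d (id : R -> R^o).
Proof.
move=> e e0; exists e => // n a b ab _; apply: le_lt_trans; rewrite le_eqVlt.
apply/orP; left; apply/eqP/eq_bigr => i _; rewrite ger0_norm// subr_ge0.
by have [] := ab i.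
Qed.

Lemma ac_cst {H : completeNormedModType R} (k : H) c d : absolutely_continuous c d (fun=> k).
Proof.
move=> e e0; exists e => // n a b ab _ _.
by rewrite big1// => i _; rewrite subrr normr0.
Qed.

Lemma ac_inner {H : completeNormedModType R} (ip : {dot H for idfun}) (f g : R -> H) c d :
  induces_norm ip -> c <= d ->
  absolutely_continuous c d f -> absolutely_continuous c d g ->
  absolutely_continuous c d ((fun t => inner ip (f t) (g t)) : R -> R^o).
Proof.
move=> ipn cd acf acg.
have [M M0 fM] := ac_bounded cd acf; have [K K0 gK] := ac_bounded cd acg.
apply: (ac_dominated (M := M + K) acf acg) => s t cs st td.
have -> : inner ip (f t) (g t) - inner ip (f s) (g s) =
   inner ip (f t - f s) (g t) + inner ip (f s) (g t - g s) by rewrite !innerE; ring.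
rewrite (le_trans (ler_normD _ _))//.
rewrite (le_trans (lerD (cauchy_schwarz ipn _ _) (cauchy_schwarz ipn _ _)))//.
have ? : `|g t| <= K by apply: gK; rewrite td (le_trans cs).
have ? : `|f s| <= M by apply: fM; rewrite cs (le_trans st).
have ? := normr_ge0 (f t - f s); have ? := normr_ge0 (g t - g s).
nra.
Qed.
End AbsolutelyContinuous.

(** * Derivatives of trajectories *)

Section Derivatives.
Context {R : realType} {H : completeNormedModType R}.

Lemma is_derive1P {V : normedModType R} (f : R -> V) (t : R) (D : V) :
  is_derive t 1 f D <-> h^-1 *: (f (h + t) - f t) @[h --> (0 : R)^'] --> D.
Proof.
have E : (fun h : R => h^-1 *: ((f \o shift t) (h *: 1) - f t)) =
    (fun h : R => h^-1 *: (f (h + t) - f t)).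
  by apply/funext => h /=; rewrite [h *: 1]mulr1.
split=> [[df <-]|fD].
  by move: df; rewrite /derivable /derive E.
by apply: DeriveDef; rewrite /derivable /derive E; [exact: cvgP fD|exact: cvg_lim fD].
Qed.

Lemma is_derive1_cvg {V : normedModType R} (f : R -> V) (t : R) (D : V) :
  is_derive t 1 f D -> f (h + t) @[h --> (0 : R)^'] --> f t.
Proof.
move=> /is_derive1P fD.
have : h *: (h^-1 *: (f (h + t) - f t)) + f t @[h --> (0:R)^'] --> 0 *: D + f t.
  apply: cvgD; last exact: cvg_cst.
  apply: cvgZ => //; exact: nbhs_dnbhs.
rewrite scale0r add0r; apply: cvg_trans; apply: near_eq_cvg.
near=> h; rewrite scalerA divff ?scale1r ?subrK//.
by near: h; exact: nbhs_dnbhs_neq.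
Unshelve. all: by end_near. Qed.

Lemma is_derive_scale (f : R -> R) (k t D : R) :
  is_derive t 1 f D -> is_derive t 1 (fun s => k * f s) (k * D).
Proof. exact: is_deriveZ. Qed.

Lemma is_derive_inner (ip : {dot H for idfun}) (f g : R -> H) (t : R) (Df Dg : H) :
  induces_norm ip -> is_derive t 1 f Df -> is_derive t 1 g Dg ->
  is_derive t 1 (fun s => inner ip (f s) (g s)) (inner ip Df (g t) + inner ip (f t) Dg).
Proof.
move=> ipn fD gD; apply/is_derive1P.
have E : (fun h : R => inner ip (h^-1 *: (f (h + t) - f t)) (g (h + t)) +
    inner ip (f t) (h^-1 *: (g (h + t) - g t))) =
    (fun h : R => h^-1 *: (inner ip (f (h + t)) (g (h + t)) - inner ip (f t) (g t))).
  by apply/funext => h; rewrite !innerE [RHS]mulrBr; ring.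
rewrite -E; apply: cvgD; apply: cvg_inner => //; try exact: cvg_cst.
- exact/is_derive1P.
- exact: is_derive1_cvg gD.
- exact/is_derive1P.
Qed.

(** A chain rule without differentiability of the potential: the two bounds on the increment differ
    by [inner ip (v s - v t) (x s - x t)], which is negligible against [s - t] because [v] is
    continuous at [t]. *)
Lemma is_derive_potential (ip : {dot H for idfun}) (phi : R -> R) (x v : R -> H)
    (t : R) (Dx Dv : H) : induces_norm ip ->
  (\forall s \near t,
    inner ip (v t) (x s - x t) <= phi s - phi t <= inner ip (v s) (x s - x t)) ->
  is_derive t 1 x Dx -> is_derive t 1 v Dv ->
  is_derive t 1 phi (inner ip (v t) Dx).
Proof.
move=> ipn sub xD vD; apply/is_derive1P.
have sub0 : \forall h \near (0 : R)^', inner ip (v t) (x (h + t) - x t) <= phi (h + t) - phi t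
    <= inner ip (v (h + t)) (x (h + t) - x t).
  apply: nbhs_dnbhs; have ht : (h + t) @[h --> (0:R)] --> t.
    by rewrite -[X in _ --> X]add0r; apply: cvgD; [exact: cvg_id|exact: cvg_cst].
  exact: (ht _ sub).
have E0 : inner ip (v (h + t) - v t) (h^-1 *: (x (h + t) - x t)) @[h --> (0:R)^'] --> (0 : R).
  rewrite -[X in _ --> X](inner0l ip Dx); apply: cvg_inner => //; last exact/is_derive1P.
  rewrite -[X in _ --> X](subrr (v t)); apply: cvgB; [exact: is_derive1_cvg vD|exact: cvg_cst].
have E1 : inner ip (v t) (h^-1 *: (x (h + t) - x t)) @[h --> (0:R)^'] --> inner ip (v t) Dx.
  by apply: cvg_inner => //; [exact: cvg_cst|exact/is_derive1P].
have E2 : (h^-1 *: (phi (h + t) - phi t) -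
    inner ip (v t) (h^-1 *: (x (h + t) - x t))) @[h --> (0:R)^'] --> (0 : R).
  apply/cvgr0Pnorm_le => e e0; near=> h.
  have : `|inner ip (v (h + t) - v t) (h^-1 *: (x (h + t) - x t))| <= e.
    by near: h; exact: (cvgr0_norm_le _ E0 _ e0).
  (* The factor [h^-1], of either sign, leaves both absolute values, so the bounds on increments
     suffice. *)
  apply: le_trans; rewrite !innerZr [_ *: _]/(_ * _) -mulrBr !normrM ler_wpM2l//.
  have : inner ip (v t) (x (h + t) - x t) <= phi (h + t) - phi t
    <= inner ip (v (h + t)) (x (h + t) - x t) by near: h.
  move=> /andP[h1 h2].
  rewrite innerDl innerNl !ger0_norm; lra.
rewrite -[inner ip (v t) Dx]add0r.
have -> : (fun h : R => h^-1 *: (phi (h + t) - phi t)) =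
   (fun h : R => h^-1 *: (phi (h + t) - phi t) -
     inner ip (v t) (h^-1 *: (x (h + t) - x t)) +
     inner ip (v t) (h^-1 *: (x (h + t) - x t))).
  by apply/funext => h; rewrite subrK.
exact: cvgD.
Unshelve. all: by end_near. Qed.

(** [inner ip Dv Dx] is the limit of the inner products of increments divided by [h ^+ 2], which are
    nonnegative. *)
Lemma derive_monotone (ip : {dot H for idfun}) (x v : R -> H) (t : R) (Dx Dv : H) :
  induces_norm ip -> (\forall s \near t, 0 <= inner ip (v s - v t) (x s - x t)) ->
  is_derive t 1 x Dx -> is_derive t 1 v Dv -> 0 <= inner ip Dv Dx.
Proof.
move=> ipn mono /is_derive1P xD /is_derive1P vD.
have vx : inner ip (h^-1 *: (v (h + t) - v t)) (h^-1 *: (x (h + t) - x t))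
    @[h --> (0 : R)^'] --> inner ip Dv Dx by exact: cvg_inner.
rewrite -(cvg_lim (@Rhausdorff R) vx).
apply: limr_ge; first exact: cvgP vx.
have mono0 : \forall h \near (0 : R)^', 0 <= inner ip (v (h + t) - v t) (x (h + t) - x t).
  apply: nbhs_dnbhs; have ht : (h + t) @[h --> (0:R)] --> t.
    by rewrite -[X in _ --> X]add0r; apply: cvgD; [exact: cvg_id|exact: cvg_cst].
  exact: (ht _ mono).
near=> h; rewrite innerZl innerZr mulrA -expr2 mulr_ge0 ?sqr_ge0//; near: h.
exact: mono0.
Unshelve. all: by end_near. Qed.
End Derivatives.

(** * Projections and asymptotic centers *)

Section Minimization.
Context {R : realType} {H : completeNormedModType R}.

(* [P y r] stands for [f y <= r] for a function [f] that is bounded below,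
   strongly midpoint-convex and closed. *)
Lemma midpoint_convex_min (P : H -> R -> Prop) :
  (exists y r, P y r) -> (forall y r, P y r -> 0 <= r) ->
  (forall y r r', r <= r' -> P y r -> P y r') ->
  (forall y y' r, P y r -> P y' r -> P (2^-1 *: (y + y')) (r - `|y - y'| ^+ 2 / 4)) ->
  (forall c r e, 0 < e -> (forall delta, 0 < delta -> exists2 y, `|c - y| < delta & P y r) ->
    P c (r + e)) ->
  exists c m, (forall e, 0 < e -> P c (m + e)) /\ (forall y r, P y r -> m <= r).
Proof.
move=> [y0 [r0 P0]] P_ge0 P_up P_mid P_closed.
pose S := [set r | exists y, P y r].
have S_inf : has_inf S.
  by split; [exists r0, y0|exists 0 => r [y /P_ge0]].
have m_le y r : P y r -> inf S <= r.
  by move=> Pyr; apply: ge_inf; [exact: S_inf.2|exists y].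
have approx e : 0 < e -> exists y, P y (inf S + e).
  move=> e0; have [r [y Pyr] /ltW re] := inf_adherent e0 S_inf.
  by exists y; exact: P_up Pyr.
have /choice[u uP] : forall n, exists y, P y (inf S + n.+1%:R^-1).
  by move=> n; apply: approx; rewrite invr_gt0.
have cauchy_u (e : R) : 0 < e -> exists N, forall n, (N <= n)%N -> `|u N - u n| < e.
  move=> e0; have e20 : 0 < e ^+ 2 / 4 by rewrite divr_gt0 ?exprn_gt0.
  have [N _ Ne] := near_infty_natSinv_lt (PosNum e20).
  exists N => n Nn; have {}Ne : N.+1%:R^-1 < e ^+ 2 / 4 by exact: (Ne N (leqnn N)).
  (* Both points lie at level [inf S + N.+1%:R^-1] while their midpoint has level at least [inf S];
     hence their squared distance is at most [4 / N.+1]. *)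
  have /(P_mid _ _ _ (uP N)) /m_le h : P (u n) (inf S + N.+1%:R^-1).
    by apply: P_up (uP n); rewrite lerD2l lef_pV2 ?posrE// ler_nat.
  rewrite -(ltr_pXn2r (n := 2)) ?nnegrE//; last exact: ltW.
  move: h Ne; set k := N.+1%:R^-1; set d := `|_|; lra.
have /cauchy_cvg : cauchy (u @ \oo).
  apply: cauchy_exP => e e0; have [N NP] := cauchy_u _ e0.
  exists (u N); exists N => // n /= Nn; by rewrite -ball_normE /=; exact: NP.
move=> /cvg_ex[c /cvgrPdist_lt uc]; exists c, (inf S); split => // e e0.
rewrite (splitr e) addrA; apply: P_closed => [|delta d0]; first by rewrite divr_gt0.
have e20 : 0 < e / 2 by rewrite divr_gt0.
have [N1 _ h1] := near_infty_natSinv_lt (PosNum e20).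
have [N2 _ h2] := uc _ d0.
exists (u (maxn N1 N2)); first by apply: h2; exact: leq_maxr.
apply: P_up (uP _); rewrite lerD2l ltW//; apply: h1; exact: leq_maxl.
Qed.

Lemma sqr_norm_perturb (r e : R) : 0 <= r -> 0 < e -> exists2 delta : R, 0 < delta &
  forall a y c : H, `|a - y| ^+ 2 <= r -> `|c - y| < delta -> `|a - c| ^+ 2 <= r + e.
Proof.
move=> r0 e0; exists (Num.min 1 (e / (2 * (r + 1) + 1))) => [|a y c ar].
  rewrite lt_min ltr01 divr_gt0//; lra.
rewrite lt_min ltr_pdivlMr; last lra.
move=> /andP[c1 ce].
have : `|a - c| <= `|a - y| + `|c - y|.
  by rewrite -(subrKA y a (- c)) (le_trans (ler_normD _ _))// (distrC y).
move: (normr_ge0 (a - c)) (normr_ge0 (a - y)) (normr_ge0 (c - y)) => p0 q0 d0 tri.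
have q1 : `|a - y| <= r + 1 by nra.
have : `|a - c| ^+ 2 <= (`|a - y| + `|c - y|) ^+ 2 by rewrite ler_pXn2r ?nnegrE ?addr_ge0.
nra.
Qed.

Definition set_convex (K : set H) : Prop :=
  forall u w (s : R), 0 < s -> s < 1 -> K u -> K w -> K (s *: u + (1 - s) *: w).

Lemma convex_mid (K : set H) u w : set_convex K -> K u -> K w -> K (2^-1 *: (u + w)).
Proof.
move=> convK Ku Kw.
have -> : 2^-1 *: (u + w) = 2^-1 *: u + (1 - 2^-1) *: w.
  by rewrite scalerDr; congr (_ + _ *: _); lra.
by apply: convK => //; lra.
Qed.

Variable ip : {dot H for idfun}.
Hypothesis ipn : induces_norm ip.

Lemma mid_norm (a y y' : H) : `|a - 2^-1 *: (y + y')| ^+ 2 =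
  `|a - y| ^+ 2 / 2 + `|a - y'| ^+ 2 / 2 - `|y - y'| ^+ 2 / 4.
Proof.
rewrite -!(inner_norm ipn) !innerE (innerC ip y a) (innerC ip y' a) (innerC ip y' y); lra.
Qed.

(** The squared distance to [a], restricted to [K], is minimized at [p]; were the inner product
    positive, moving from [p] slightly towards [k] would come closer to [a]. *)
Lemma projection (K : set H) (a : H) : closed K -> set_convex K -> K !=set0 ->
  exists2 p, K p & forall k, K k -> inner ip (a - p) (k - p) <= 0.
Proof.
move=> cK convK [k0 Kk0].
pose P y (r : R) := K y /\ `|a - y| ^+ 2 <= r.
have [|||||p [m [mP mle]]] := @midpoint_convex_min P.
- by exists k0, (`|a - k0| ^+ 2); split.
- by move=> y r [_]; apply: le_trans; rewrite sqr_ge0.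
- by move=> y r r' rr' [Ky ?]; split=> //; exact: le_trans rr'.
- move=> y y' r [Ky yr] [Ky' yr']; split; first exact: convex_mid.
  rewrite mid_norm; lra.
- move=> c r e e0 h; split.
    apply: cK => B /nbhs_ballP[d /= d0 dB]; have [y yd [Ky _]] := h _ d0.
    by exists y; split=> //; apply: dB; rewrite -ball_normE.
  have [y0 _ [_ y0r]] := h _ ltr01.
  have r0 : 0 <= r by apply: le_trans y0r; rewrite sqr_ge0.
  have [delta d0 dP] := sqr_norm_perturb r0 e0.
  by have [y yd [Ky yr]] := h _ d0; exact: dP yd.
have Kp : K p by have [] := mP 1 ltr01.
have p_le k : K k -> `|a - p| ^+ 2 <= `|a - k| ^+ 2.
  move=> Kk; have /mle h : P k (`|a - k| ^+ 2) by [].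
  apply: le_trans h; apply/ler_addgt0Pr => e e0; by have [] := mP e e0.
exists p => // k Kk; rewrite leNgt; apply/negP => h.
set i := inner _ _ _ in h; set n := `|k - p| ^+ 2.
have n0 : 0 <= n by rewrite sqr_ge0.
(* Since [s * n <= i], the gain [2 * s * i] exceeds the loss [s ^+ 2 * n]; the bound [2^-1] keeps
   [s < 1]. *)
pose s := Num.min 2^-1 (i / (n + 1)).
have s0 : 0 < s by rewrite lt_min divr_gt0//; lra.
have s1 : s < 1 by rewrite gt_min; apply/orP; left; lra.
have si : s * (n + 1) <= i.
  by rewrite -ler_pdivlMr ?ge_min ?lexx ?orbT//; lra.
have := p_le _ (convK _ _ _ s0 s1 Kk Kp).
have -> : `|a - (s *: k + (1 - s) *: p)| ^+ 2 = `|a - p| ^+ 2 - 2 * s * i + s ^+ 2 * n.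
  rewrite /i /n -!(inner_norm ipn) !innerE (innerC ip k a) (innerC ip p a) (innerC ip p k); lra.
nra.
Qed.
End Minimization.

(** * Asymptotic centers along a filter and weak convergence *)

Section AsymptoticCenter.
Context {R : realType} {H : completeNormedModType R} (ip : {dot H for idfun}).
Hypothesis ipn : induces_norm ip.
Context {T : Type}.
Implicit Types (F : set_system T) (x : T -> H).

(** [m] is the least upper limit of [|x t - y|^2] over all [y], attained at [c]; upper limits are
    expressed through eventual bounds. *)
Definition asymptotic_center F x (c : H) := exists m : R,
  (forall e, 0 < e -> \forall t \near F, `|x t - c| ^+ 2 <= m + e) /\
  (forall y r, (\forall t \near F, `|x t - y| ^+ 2 <= r) -> m <= r).

Lemma asymptotic_center_exists F {FF : ProperFilter F} x (M : R) :
  (\forall t \near F, `|x t| <= M) -> exists c, asymptotic_center F x c.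
Proof.
move=> xM; pose P y (r : R) := \forall t \near F, `|x t - y| ^+ 2 <= r.
have P_ge0 y r : P y r -> 0 <= r.
  by move=> /filter_ex[t]; apply: le_trans; rewrite sqr_ge0.
have [|||||c [m [h1 h2]]] := @midpoint_convex_min R H P; last by exists c, m.
- exists 0, (M ^+ 2); apply: filterS xM => t xtM.
  by rewrite subr0 ler_pXn2r ?nnegrE// (le_trans _ xtM).
- exact: P_ge0.
- by move=> y r r' rr'; rewrite /P; apply: filterS => t /le_trans; apply.
- by move=> y y' r; rewrite /P; apply: filterS2 => t ? ?; rewrite (mid_norm ipn); lra.
- move=> c r e e0 h; have [y0 _ /P_ge0 r0] := h _ ltr01.
  have [delta d0 dP] := sqr_norm_perturb (H := H) r0 e0.
  have [y yd] := h _ d0; rewrite /P; apply: filterS => t xr; exact: dP xr yd.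
Qed.

(** The projection [p] of [c] on [K] is closer than [c] to every point of [K], by at least
    [|c - p|^2] in squared distance, so minimality of [c] forces [c = p]. *)
Lemma asymptotic_center_mem F {FF : ProperFilter F} x c (K : set H) :
  asymptotic_center F x c -> closed K -> set_convex K ->
  (\forall t \near F, K (x t)) -> K c.
Proof.
move=> [m [mP mle]] cK convK xK.
have [t0 Kt0] := filter_ex xK.
have [|p Kp pP] := projection ipn c cK convK; first by exists (x t0).
suff -> : c = p by [].
apply/eqP; rewrite -subr_eq0 -normr_le0 leNgt; apply/negP => cp0.
have e0 : 0 < `|c - p| ^+ 2 / 2 by rewrite divr_gt0// exprn_gt0.
suff /mle : \forall t \near F, `|x t - p| ^+ 2 <= m - `|c - p| ^+ 2 / 2 by lra.
apply: filterS2 xK (mP _ e0) => t /pP.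
rewrite -!(inner_norm ipn) !innerE (innerC ip (x t) c)
  (innerC ip (x t) p) (innerC ip p c); lra.
Qed.

(* Opial's argument, with asymptotic centers playing the part of weak cluster points. *)
Lemma asymptotic_center_weak F {FF : ProperFilter F} x (S : set H) (M : R) :
  (\forall t \near F, `|x t| <= M) ->
  (forall z, S z -> exists l : R, `|x t - z| ^+ 2 @[t --> F] --> l) ->
  (forall G c, ProperFilter G -> G `=>` F -> asymptotic_center G x c -> S c) ->
  exists2 c, S c & forall y, inner ip (x t) y @[t --> F] --> inner ip c y.
Proof.
move=> xM dist_cvg SG.
have [c cF] := asymptotic_center_exists xM.
have Sc : S c by apply: (SG F).
exists c => //; have [m [mP mle]] := cF.
suff main y e : 0 < e -> \forall t \near F, inner ip (x t - c) y <= e.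
  move=> y; apply/cvgrPdist_le => e e0.
  apply: filterS2 (main y e e0) (main (- y) e e0) => t.
  rewrite !innerE ler_norml => ? ?; apply/andP; split; lra.
move=> e0; apply: contrapT => nxe.
(* If the bound fails, [F] restricted to [D] is still a proper filter, and it has its own center
   [c'], also in [S]. *)
pose D := [set t | e < inner ip (x t - c) y].
have GF : within D F `=>` F by exact: cvg_within.
have GP : ProperFilter (within D F).
  apply: Build_ProperFilter_ex => B DB; apply: contrapT => nB; apply: nxe.
  have {}DB : \forall t \near F, D t -> B t := DB.
  apply: filterS DB => t DB; rewrite leNgt; apply/negP => /DB Bt.
  by apply: nB; exists t.
have [c' c'G] := asymptotic_center_exists (FF := GP) (GF _ xM).
have [m' [m'P m'le]] := c'G.
have [l lP] := dist_cvg _ Sc; have [l' l'P] := dist_cvg _ (SG _ _ GP GF c'G).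
have near_le (z : H) k d : `|x t - z| ^+ 2 @[t --> F] --> k -> 0 < d ->
    \forall t \near F, k - d <= `|x t - z| ^+ 2 <= k + d.
  move=> /cvgrPdist_le h d0; apply: filterS (h _ d0) => t.
  by rewrite ler_norml => /andP[? ?]; apply/andP; split; lra.
(* [c] is optimal along [F], and the squared distances to [c] and to [c'] both converge along
   [F]. *)
have ll' : l <= l'.
  apply/ler_addgt0Pr => d d0; have d20 : 0 < d / 3 by rewrite divr_gt0.
  have : m <= l' + d / 3.
    by apply: (mle c'); apply: filterS (near_le _ _ _ l'P d20) => t /andP[].
  have [t [/andP[? ?] ?]] := filter_ex (filterI (near_le _ _ _ lP d20) (mP _ d20)).
  lra.
pose n := `|y| ^+ 2; have n0 : 0 <= n by rewrite sqr_ge0.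
(* Along [D], moving the center from [c] to [c + s *: y] gains more than [2 * s * e] and costs
   [s ^+ 2 * n <= s * e]. Thus [c'] does strictly better than [c], that is [l' < l], against
   [ll']. *)
pose s := e / (n + 1); have s0 : 0 < s by rewrite divr_gt0//; lra.
have sn : s * (n + 1) = e by rewrite divfK// gt_eqF//; lra.
have se0 : 0 < s * e / 4 by rewrite divr_gt0// mulr_gt0.
have : m' <= l + s * e / 4 - s * e.
  apply: (m'le (c + s *: y)).
  have xD : \forall t \near within D F, D t by exact: withinT.
  apply: filterS2 xD (GF _ (near_le _ _ _ lP se0)) => t /ltW Dt /andP[_].
  have -> : `|x t - (c + s *: y)| ^+ 2 =
      `|x t - c| ^+ 2 - 2 * s * inner ip (x t - c) y + s ^+ 2 * n.
    rewrite /n -!(inner_norm ipn) !innerE (innerC ip (x t) c)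
      (innerC ip y (x t)) (innerC ip y c); lra.
  nra.
have [t [/andP[? ?] ?]] := filter_ex (filterI (GF _ (near_le _ _ _ l'P se0)) (m'P _ se0)).
lra.
Qed.

End AsymptoticCenter.

(** * Subdifferentials and zeros *)

Section Subdifferential.
Context {R : realType} {H : completeNormedModType R} (ip : {dot H for idfun}).
Hypothesis ipn : induces_norm ip.
Variable Phi : H -> \bar R.
Hypothesis Phi_proper : proper_function Phi.

Lemma subdifferential_fin u p : subdifferential ip Phi u p -> Phi u \is a fin_num.
Proof.
move=> up; have [nPhi [w wfin]] := Phi_proper.
rewrite fin_numE nPhi /=; apply/eqP => uoo; have := up w.
by rewrite uoo addye// leye_eq (negPf wfin).
Qed.

Lemma subgradient_le u w p q : subdifferential ip Phi u p -> subdifferential ip Phi w q ->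
  fine (Phi u) + inner ip p (w - u) <= fine (Phi w).
Proof.
move=> up wq; have := up w.
have uf := subdifferential_fin up; have wf := subdifferential_fin wq.
by rewrite -(fineK uf) -(fineK wf) -EFinD lee_fin.
Qed.

Lemma subdifferential_monotone u w p q :
  subdifferential ip Phi u p -> subdifferential ip Phi w q ->
  0 <= inner ip (p - q) (u - w).
Proof.
move=> up wq; have := subgradient_le up wq; have := subgradient_le wq up.
rewrite !innerE; lra.
Qed.

Variable B : H -> H.

Lemma zerosP z : zeros ip Phi B z <-> subdifferential ip Phi z (- B z).
Proof.
split=> [[p zp /eqP]|zp]; last by exists (- B z) => //; rewrite addNr.
by rewrite addr_eq0 => /eqP <-.
Qed.

Variable beta : R.
Hypothesis beta_gt0 : 0 < beta.
Hypothesis B_coco : cocoercive ip beta B.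

Lemma coco u w : beta * `|B u - B w| ^+ 2 <= inner ip (B u - B w) (u - w).
Proof. exact: B_coco. Qed.

Lemma cocoercive_lipschitz u w : `|B u - B w| <= beta^-1 * `|u - w|.
Proof.
have := le_trans (coco u w) (inner_le ipn _ _).
have [->|n0] := eqVneq (B u - B w) 0.
  by move=> _; rewrite normr0 mulr_ge0// invr_ge0 ltW.
rewrite expr2 mulrCA ler_pM2l ?normr_gt0// => h.
by rewrite -(ler_pM2l beta_gt0) mulrA divff ?mul1r// gt_eqF.
Qed.

(** Monotonicity of the subdifferential makes [inner ip (B z - B z') (z - z')] nonpositive, while
    cocoercivity bounds it below by [beta * |B z - B z'|^2]. *)
Lemma zeros_uniq z z' : zeros ip Phi B z -> zeros ip Phi B z' -> B z = B z'.
Proof.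
move=> /zerosP zp /zerosP zp'; have := subdifferential_monotone zp zp'.
have := coco z z'; have := ipn (B z - B z').
rewrite -/(inner _ _ _) !innerE => _ h h'.
apply/eqP; rewrite -subr_eq0 -normr_le0 leNgt; apply/negP => n0.
have : 0 < beta * `|B z - B z'| ^+ 2 by rewrite mulr_gt0// exprn_gt0.
lra.
Qed.

Hypothesis Phi_convex : econvex Phi.
Hypothesis Phi_lsc : lower_semicontinuous Phi.

(** At a limit point violating the inequality, a value [b] strictly between the two sides keeps them
    apart on a neighborhood, by semicontinuity of [Phi] and continuity of the affine side. *)
Lemma affine_sublevel_closed (w : H) (a : R) :
  closed [set y | (Phi y <= (inner ip w y + a)%:E)%E].
Proof.
move=> y0 y0K /=; rewrite leNgt; apply/negP => h.
have [b ab bPhi] : exists2 b : R, inner ip w y0 + a < b & (b%:E < Phi y0)%E.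
  case: (Phi y0) h => [r| |] //=.
    rewrite lte_fin => h; exists ((inner ip w y0 + a + r) / 2); rewrite ?lte_fin; lra.
  by move=> _; exists (inner ip w y0 + a + 1); rewrite ?ltry//; lra.
have [V nV VP] := Phi_lsc bPhi.
have nW : \forall y \near y0, inner ip w y + a < b.
  have : inner ip w y + a @[y --> y0] --> inner ip w y0 + a.
    apply: cvgD; last exact: cvg_cst.
    by apply: cvg_inner => //; exact: cvg_cst.
  by move=> /cvgr_lt; apply.
have [y [/= yK [/VP Vy Wy]]] := y0K _ (filterI nV nW).
have := lt_le_trans Vy yK; rewrite lte_fin; lra.
Qed.

Lemma affine_sublevel_convex (w : H) (a : R) :
  set_convex [set y | (Phi y <= (inner ip w y + a)%:E)%E].
Proof.
move=> y y' s s0 s1 /= yK y'K; apply: le_trans (Phi_convex _ _ s0 s1) _.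
have -> : inner ip w (s *: y + (1 - s) *: y') + a =
   s * (inner ip w y + a) + (1 - s) * (inner ip w y' + a) by rewrite !innerE; ring.
by rewrite [leRHS]EFinD !EFinM leeD// lee_pmul2l// lte_fin; lra.
Qed.

(* For [B] the half-spaces [<B y - B z, y - .> >= - e] are used: a point lying in
   all of them satisfies [B c = B z] by Minty's trick. *)
Lemma asymptotic_center_zeros {T : Type} (F : set_system T) {FF : ProperFilter F}
    (x v : T -> H) (M : R) (z c : H) :
  zeros ip Phi B z -> (\forall t \near F, `|x t| <= M) ->
  (\forall t \near F, subdifferential ip Phi (x t) (v t)) ->
  v t @[t --> F] --> - B z -> B (x t) @[t --> F] --> B z ->
  asymptotic_center F x c -> zeros ip Phi B c.
Proof.
move=> /zerosP zp xM xv vw Bxz cx.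
have M0 : 0 <= M by have [t] := filter_ex xM; apply: le_trans.
set w := - B z in vw zp; set phiz := fine (Phi z).
have zf := subdifferential_fin zp.
have small (f : T -> H) (l y : H) (e : R) : f t @[t --> F] --> l -> 0 < e ->
    \forall t \near F, inner ip (f t - l) (x t - y) <= e.
  move=> fl e0; have k0 : 0 < M + `|y| + 1 by rewrite ltr_wpDl// addr_ge0.
  have k1 : 0 < e / (M + `|y| + 1) by rewrite divr_gt0.
  move/cvgrPdist_le : fl => /(_ _ k1); apply: filterS2 xM => t xt ft.
  apply: le_trans (inner_le ipn _ _) _.
  rewrite -(divfK (lt0r_neq0 k0) e) ler_pM ?normr_ge0//; first by rewrite distrC.
  by rewrite (le_trans (ler_normB _ _))// -addrA lerD// lerDl.
(* The subgradient inequality at [x t], tested at [z], gives this bound for [x t] up to [e], as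
   [v t] tends to [w]; the closed convex sublevel set passes it on to [c]. *)
have Phic : (Phi c <= (inner ip w (c - z) + phiz)%:E)%E.
  apply/lee_addgt0Pr => e e0.
  suff : [set y | (Phi y <= (inner ip w y + (phiz - inner ip w z + e))%:E)%E] c.
    rewrite /= -EFinD; congr (_ <= _%:E)%E; rewrite !innerE; ring.
  apply: (asymptotic_center_mem (FF := FF) ipn cx).
  - exact: affine_sublevel_closed.
  - exact: affine_sublevel_convex.
  - apply: filterS2 xv (small v w z e vw e0) => t xvt h /=.
    rewrite -(fineK (subdifferential_fin xvt)) lee_fin.
    have := subgradient_le xvt zp; move: h; rewrite /phiz !innerE; lra.
(* By [Phic], the affine function of slope [w] through [c] lies below the one supporting [Phi] at
   [z]. *)
have cw : subdifferential ip Phi c w.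
  move=> y; apply: le_trans (zp y); rewrite -(fineK zf) -/phiz.
  apply: le_trans (leeD2r _ Phic) _; rewrite -!EFinD lee_fin -!/(inner _ _ _) !innerE; lra.
suff Bcz : B c = B z by apply/zerosP; rewrite Bcz.
have minty y e : 0 < e -> - e <= inner ip (B y - B z) (y - c).
  move=> e0; pose u := B y - B z.
  suff : [set y' | inner ip u y' <= inner ip u y + e] c by rewrite /= /u !innerE; lra.
  apply: (asymptotic_center_mem (FF := FF) ipn cx).
  - have -> : [set y' | inner ip u y' <= inner ip u y + e] =
       (fun y' => inner ip u y') @^-1` [set r | r <= inner ip u y + e] by [].
    apply: closed_comp; last exact: closed_le.
    by move=> y' _; apply: cvg_inner => //; exact: cvg_cst.
  - move=> a b s s0 s1 /= ha hb; rewrite innerDr !innerZr.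
    move: (inner ip u a) (inner ip u b) (inner ip u y + e) ha hb => p q r ha hb.
    nra.
  - apply: filterS (small (B \o x) (B z) y e Bxz e0) => t /= h.
    have : 0 <= inner ip (B y - B (x t)) (y - x t).
      by apply: le_trans (coco _ _); rewrite mulr_ge0 ?sqr_ge0// ltW.
    by move: h; rewrite /u !innerE; lra.
apply/eqP; rewrite -subr_eq0 -normr_le0 leNgt; apply/negP; set d := B c - B z => d0.
have n0 : 0 < `|d| ^+ 2 by rewrite exprn_gt0.
(* [B] is Lipschitz with constant [beta^-1], so at [c - s *: d] it has moved by at most [|d| / 2],
   and its difference with [B z] keeps an inner product of at least [|d|^2 / 2] with [d]. *)
pose s := beta / 2; have s0 : 0 < s by rewrite divr_gt0.
have e0 : 0 < s * `|d| ^+ 2 / 4 by rewrite divr_gt0// mulr_gt0.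
have := minty (c - s *: d) _ e0.
have lip := cocoercive_lipschitz c (c - s *: d).
have -> : c - s *: d - c = - (s *: d) by rewrite addrAC subrr add0r.
rewrite subKr normrZ gtr0_norm// mulrA /s mulrA mulVf ?gt_eqF// mul1r in lip.
have -> : B (c - s *: d) - B z = d - (B c - B (c - s *: d)).
  by rewrite /d opprB [RHS]addrC subrKA.
have : inner ip (B c - B (c - s *: d)) d <= `|d| ^+ 2 / 2.
  apply: le_trans (inner_le ipn _ _) _.
  by rewrite expr2 mulrAC ler_pM2r//; apply: le_trans lip _; rewrite mulrC.
move: (B c - B (c - s *: d)) => r hr.
rewrite innerNr innerZr innerDl innerNl (inner_norm ipn); nra.
Qed.
End Subdifferential.

(** * Lyapunov analysis *)

Lemma nonincreasing_cvg_pinfty {R : realType} (f : R -> R) :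
  (forall c d, 0 <= c -> c <= d -> f d <= f c) -> (forall t, 0 <= t -> 0 <= f t) ->
  exists l : R, f t @[t --> +oo] --> l.
Proof.
move=> f_dec f_ge0; pose S := [set f t | t in [set t | 0 <= t]].
have S_inf : has_inf S.
  split; first by exists (f 0), 0 => //=; exact: lexx.
  by exists 0 => _ [t t0 <-]; exact: f_ge0.
exists (inf S); apply/cvgrPdist_le => e e0.
have [_ [t0 t00 <-] ft0] := inf_adherent e0 S_inf.
near=> t.
have t0t : t0 <= t by near: t; apply: nbhs_pinfty_ge; exact: num_real.
have ft : f t <= f t0 by exact: f_dec.
have : inf S <= f t by apply: ge_inf; [exact: S_inf.2|exists t => //=; exact: le_trans t0t].
move=> h; rewrite ler_norml; apply/andP; split; lra.
Unshelve. all: by end_near. Qed.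

Lemma cvg_pinfty_ge {R : realType} (f : R -> R) (l e : R) :
  f t @[t --> +oo] --> l -> 0 < e ->
  exists2 T, 0 <= T & forall t, T <= t -> l - e <= f t <= l + e.
Proof.
move=> /cvgrPdist_le h e0; have [M [_ MP]] := h _ e0.
exists (Num.max 0 (M + 1)); first by rewrite le_max lexx.
move=> t; rewrite ge_max => /andP[_ Mt]; have := MP t.
by rewrite ler_norml => /(_ _)/andP[|? ?]; first lra; apply/andP; split; lra.
Qed.

Section Trajectory.
Context {R : realType} {H : completeNormedModType R} (ip : {dot H for idfun}).
Hypothesis ipn : induces_norm ip.
Variables (Phi : H -> \bar R) (B : H -> H) (beta lambda : R).
Hypothesis Phi_proper : proper_function Phi.
Hypotheses (beta_gt0 : 0 < beta) (lambda_gt0 : 0 < lambda).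
Hypothesis B_coco : cocoercive ip beta B.
Variables (x0 v0 : H) (x v : R -> H).
Hypothesis xv_sol : strong_global_solution ip Phi B lambda x0 v0 x v.
Variable z : H.
Hypothesis zS : zeros ip Phi B z.

Let u t := v t + B z.
Let b t := B (x t) - B z.
Let phi t := fine (Phi (x t)).
Definition bregman t := phi t - fine (Phi z) + inner ip (B z) (x t - z).
Local Notation G := bregman.
(** The terms in [B z] cancel between [G] and [u], leaving the Bregman-type expression of the
    overview. This form makes the derivative of [E] depend on [z] only through [x t - z]. *)
Definition energy t :=
  lambda / 2 * inner ip (x t - z) (x t - z) - G t + inner ip (u t) (x t - z).
Local Notation E := energy.

Lemma phi_increment s t : 0 <= s -> 0 <= t ->
  inner ip (v s) (x t - x s) <= phi t - phi s <= inner ip (v t) (x t - x s).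
Proof.
move=> s0 t0; have vs := solution_subdiff xv_sol s0.
have vt := solution_subdiff xv_sol t0.
have := subgradient_le Phi_proper vs vt; have := subgradient_le Phi_proper vt vs.
rewrite -/(phi s) -/(phi t) !innerE => ? ?; apply/andP; split; lra.
Qed.

Lemma ac_phi c d : 0 <= c -> c <= d -> absolutely_continuous c d x ->
  absolutely_continuous c d v -> absolutely_continuous c d (phi : R -> R^o).
Proof.
move=> c0 cd acx acv; have [M M0 vM] := ac_bounded cd acv.
apply: (ac_dominated (M := M) acx acx) => s t cs st td.
have s0 := le_trans c0 cs.
have /andP[h1 h2] := phi_increment s0 (le_trans s0 st).
have vs : `|v s| <= M by apply: vM; rewrite cs (le_trans st).
have vt : `|v t| <= M by apply: vM; rewrite td (le_trans cs).
have := cauchy_schwarz ipn (v s) (x t - x s); have := cauchy_schwarz ipn (v t) (x t - x s).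
rewrite !ler_norml => /andP[_ h3] /andP[h4 _].
have n0 := normr_ge0 (x t - x s); apply/andP; split; nra.
Qed.

(* All the Lyapunov functions below are instances of this combination. *)
Definition lyap (alpha gamma delta k : R) (e : H) t :=
  alpha * (2^-1 * inner ip (u t) (u t)) + gamma * G t + delta * E t + k * t + inner ip (x t) e.

(** The left side of the hypothesis is the derivative of [lyap], so [ac_nondecreasing] applies to
    [- lyap]. With [Dx] and [Dv] arbitrary vectors, each use becomes an inequality between inner
    products. *)
Lemma lyapunov (alpha gamma delta k : R) (e : H) (c d : R) : 0 <= c -> c <= d ->
  (forall t Dx Dv, c < t < d -> 0 <= inner ip Dv Dx ->
     lambda *: Dx + Dv + v t + B (x t) = 0 ->
     alpha * inner ip Dv (u t) + gamma * inner ip (u t) Dx +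
     delta * (lambda * inner ip Dx (x t - z) + inner ip Dv (x t - z)) +
     k + inner ip Dx e <= 0) ->
  lyap alpha gamma delta k e d <= lyap alpha gamma delta k e c.
Proof.
move=> c0 cd H0; set f := lyap _ _ _ _ _; rewrite -lerN2.
(* This case is set apart since absolute continuity on [[0, d]] is given for [0 < d]. *)
have [cd0|cd'] := eqVneq c d; first by rewrite cd0 lexx.
have d0 : 0 < d by apply: le_lt_trans c0 _; rewrite lt_neqAle cd'.
have acx := ac_subitv c0 (lexx d) (solution_acx xv_sol d0).
have acv := ac_subitv c0 (lexx d) (solution_acv xv_sol d0).
have acu : absolutely_continuous c d u by apply: acD => //; exact: ac_cst.
have acxz : absolutely_continuous c d (fun t => x t - z) by apply: acD => //; exact: ac_cst.
have acG : absolutely_continuous c d (G : R -> R^o).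
  apply: (@acD _ R^o (fun t => phi t - fine (Phi z))).
    apply: (@acD _ R^o phi); [exact: ac_phi|exact: ac_cst].
  by apply: ac_inner => //; exact: ac_cst.
have acE : absolutely_continuous c d (E : R -> R^o).
  apply: (@acD _ R^o (fun t => lambda / 2 * inner ip (x t - z) (x t - z) - G t)); last exact: ac_inner.
  apply: (@acD _ R^o (fun t => lambda / 2 * inner ip (x t - z) (x t - z)) (fun t => - G t)).
    by apply: (@acZ _ R^o); exact: ac_inner.
  have -> : (fun t => - G t) = (fun t => (-1) *: (G t : R^o))
    by apply/funext => t; rewrite scaleN1r.
  exact: acZ.
have acf : absolutely_continuous c d (f : R -> R^o).
  apply: (@acD _ R^o (fun t =>
    alpha * (2^-1 * inner ip (u t) (u t)) + gamma * G t + delta * E t + k * t)); last first.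
    by apply: ac_inner => //; exact: ac_cst.
  apply: (@acD _ R^o (fun t =>
    alpha * (2^-1 * inner ip (u t) (u t)) + gamma * G t + delta * E t)); last first.
    by apply: (@acZ _ R^o); exact: ac_id.
  apply: (@acD _ R^o (fun t =>
    alpha * (2^-1 * inner ip (u t) (u t)) + gamma * G t)); last first.
    by apply: (@acZ _ R^o).
  apply: (@acD _ R^o (fun t => alpha * (2^-1 * inner ip (u t) (u t)))); last first.
    by apply: (@acZ _ R^o).
  by apply: (@acZ _ R^o); apply: (@acZ _ R^o); exact: ac_inner.
have acNf : absolutely_continuous c d ((fun t => - f t) : R -> R^o).
  have -> : (fun t => - f t) = (fun t => (-1) *: (f t : R^o))
    by apply/funext => t; rewrite scaleN1r.
  exact: acZ.
apply: (ac_nondecreasing (f := fun t => - f t)) => //.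
apply: (negligibleS _ (solution_ode xv_sol)); apply: subsetC => t ode ctd.
have t0 : 0 < t by apply: le_lt_trans c0 _; case/andP: ctd.
have [dx dv ode_t] := ode (ltW t0).
set Dx : H := derive1 x t in ode_t; set Dv : H := derive1 v t in ode_t.
have xD : is_derive t 1 x Dx by rewrite /Dx derive1E; exact: derivableP.
have vD : is_derive t 1 v Dv by rewrite /Dv derive1E; exact: derivableP.
have pos_near : \forall s \near t, 0 < s by exact: lt_nbhsr.
have mono : 0 <= inner ip Dv Dx.
  apply: (derive_monotone ipn _ xD vD); apply: filterS pos_near => s s0.
  apply: (subdifferential_monotone Phi_proper); apply: (solution_subdiff xv_sol) => //; exact: ltW.
have phiD : is_derive t 1 phi (inner ip (v t) Dx).
  apply: (is_derive_potential ipn _ xD vD); apply: filterS pos_near => s s0.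
  by apply: phi_increment => //; exact: ltW.
have uD : is_derive t 1 u Dv.
  by rewrite -[Dv]addr0; apply: is_deriveD.
have xzD : is_derive t 1 (fun s => x s - z) Dx.
  by rewrite -[Dx]subr0; apply: is_deriveB.
have GD : is_derive t 1 G (inner ip (u t) Dx).
  have -> : inner ip (u t) Dx = inner ip (v t) Dx - 0 + (inner ip 0 (x t - z) + inner ip (B z) Dx).
    by rewrite !innerE; ring.
  apply: is_deriveD; last exact: is_derive_inner.
have ED : is_derive t 1 E (lambda * inner ip Dx (x t - z) + inner ip Dv (x t - z)).
  (* The derivative of [- G] cancels the term [inner ip (u t) Dx] of the product rule. *)
  have -> : lambda * inner ip Dx (x t - z) + inner ip Dv (x t - z) =
    lambda / 2 * (inner ip Dx (x t - z) + inner ip (x t - z) Dx) - inner ip (u t) Dx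
     + (inner ip Dv (x t - z) + inner ip (u t) Dx).
    rewrite (innerC ip (x t - z)); lra.
  apply: is_deriveD; last exact: is_derive_inner.
  apply: is_deriveB; apply: is_deriveZ; exact: is_derive_inner.
have fD : is_derive t 1 f (alpha * inner ip Dv (u t) + gamma * inner ip (u t) Dx +
     delta * (lambda * inner ip Dx (x t - z) + inner ip Dv (x t - z)) +
     k + inner ip Dx e).
  have -> : alpha * inner ip Dv (u t) + gamma * inner ip (u t) Dx +
     delta * (lambda * inner ip Dx (x t - z) + inner ip Dv (x t - z)) +
     k + inner ip Dx e =
     alpha * (2^-1 * (inner ip Dv (u t) + inner ip (u t) Dv)) + gamma * inner ip (u t) Dx +
     delta * (lambda * inner ip Dx (x t - z) + inner ip Dv (x t - z)) +
     k * 1 + (inner ip Dx e + inner ip (x t) 0).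
    rewrite (innerC ip (u t) Dv) inner0r; lra.
  have hU := is_derive_scale alpha (is_derive_scale 2^-1 (is_derive_inner ipn uD uD)).
  have hG := is_derive_scale gamma GD.
  have hE := is_derive_scale delta ED.
  have hk := is_derive_scale k (is_derive_id t 1).
  have he := is_derive_inner ipn xD (is_derive_cst e t 1).
  exact: (is_deriveD (is_deriveD (is_deriveD (is_deriveD hU hG) hE) hk) he).
exists (- (alpha * inner ip Dv (u t) + gamma * inner ip (u t) Dx +
     delta * (lambda * inner ip Dx (x t - z) + inner ip Dv (x t - z)) +
     k + inner ip Dx e)); last exact: is_deriveN.
by rewrite oppr_ge0; exact: H0.
Qed.


Lemma velocityE t : u t + b t = v t + B (x t).
Proof. by rewrite /u /b addrACA addrN addr0. Qed.

Lemma ode_velocity t Dx Dv : lambda *: Dx + Dv + v t + B (x t) = 0 ->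
  Dv = - (lambda *: Dx + u t + b t).
Proof.
have -> : lambda *: Dx + Dv + v t + B (x t) = Dv + (lambda *: Dx + u t + b t).
  by rewrite -[_ + u t + _]addrA velocityE addrCA !addrA.
by move/eqP; rewrite addr_eq0 => /eqP.
Qed.

Lemma u_monotone t : 0 <= t -> 0 <= inner ip (u t) (x t - z).
Proof.
move=> t0; have /zerosP zp := zS.
have := subdifferential_monotone Phi_proper (solution_subdiff xv_sol t0) zp.
by rewrite opprK.
Qed.

Lemma B_increment_coercive t : beta * inner ip (b t) (b t) <= inner ip (b t) (x t - z).
Proof. by rewrite (inner_norm ipn); exact: coco. Qed.

Lemma bregman_ge0 t : 0 <= t -> 0 <= G t.
Proof.
move=> t0; have /zerosP zp := zS.
have := subgradient_le Phi_proper zp (solution_subdiff xv_sol t0).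
rewrite /bregman -/(phi t) !innerE; lra.
Qed.

Lemma energy_ge t : 0 <= t -> lambda / 2 * inner ip (x t - z) (x t - z) <= E t.
Proof.
move=> t0; have /zerosP zp := zS.
have := subgradient_le Phi_proper (solution_subdiff xv_sol t0) zp.
rewrite /energy /bregman -/(phi t) /u; set X := lambda / 2 * _; rewrite !innerE; lra.
Qed.

Lemma energy_ge0 t : 0 <= t -> 0 <= E t.
Proof.
move=> t0; apply: le_trans (energy_ge t0).
by rewrite (inner_norm ipn) mulr_ge0 ?sqr_ge0// divr_ge0// ltW.
Qed.

(** By the equation [E' = - <u + b, x - z>], where [<u, x - z>] is nonnegative by monotonicity and
    [<b, x - z>] is at least [beta |b|^2]. *)
Lemma energy_decay c d k : 0 <= c -> c <= d ->
  (forall t, c < t < d -> k <= beta * inner ip (b t) (b t)) ->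
  E d + k * (d - c) <= E c.
Proof.
move=> c0 cd kb; have := @lyapunov 0 0 1 k 0 c d c0 cd.
rewrite /lyap !inner0r => h; refine ((fun hd => _) (h _)); first by lra.
move=> {h} t Dx Dv ctd _ /ode_velocity ->.
have t0 : 0 <= t by case/andP: ctd => /ltW ct _; exact: le_trans ct.
have := u_monotone t0; have := B_increment_coercive t; have := kb _ ctd.
rewrite inner0r !(innerNl, innerDl _ _ (b t), innerDl _ _ (u t), innerZl); lra.
Qed.

(** The weight [2 * lambda * beta] makes the [|b|^2] terms of the bounds on [G'] and [E'] cancel, so
    that [W' <= - lambda^2 beta |x'|^2]. *)
Definition potential t := 2 * lambda * beta * G t + E t.
Local Notation W := potential.

(** In the bound on [W'], [|x'|^2] is replaced by its tangent minorant [2 <x', e> - |e|^2], which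
    has an explicit primitive. *)
Lemma potential_decay (e : H) c d : 0 <= c -> c <= d ->
  W d + 2 * lambda ^+ 2 * beta * inner ip (x d) e
    - lambda ^+ 2 * beta * inner ip e e * (d - c) <=
  W c + 2 * lambda ^+ 2 * beta * inner ip (x c) e.
Proof.
move=> c0 cd.
have := @lyapunov 0 (2 * lambda * beta) 1 (- (lambda ^+ 2 * beta * inner ip e e))
  ((2 * lambda ^+ 2 * beta) *: e) c d c0 cd.
rewrite /lyap !innerZr /W => h; refine ((fun hd => _) (h _)); first by lra.
move=> {h} t Dx Dv ctd + /ode_velocity DvE; rewrite {}DvE.
have t0 : 0 <= t by case/andP: ctd => /ltW ct _; exact: le_trans ct.
have hu := u_monotone t0; have hb := B_increment_coercive t.
move: (u t) (b t) (x t - z) hu hb => U V Y hu hb mono.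
have sq1 : 0 <= inner ip (Dx - e) (Dx - e) by rewrite (inner_norm ipn) sqr_ge0.
have sq2 : 0 <= inner ip (lambda *: Dx + V) (lambda *: Dx + V).
  by rewrite (inner_norm ipn) sqr_ge0.
have lb0 : 0 <= lambda ^+ 2 * beta by rewrite mulr_ge0 ?sqr_ge0// ltW.
have {}mono := mulr_ge0 (mulr_ge0 (ltW lambda_gt0) (ltW beta_gt0)) mono.
have {}sq2 := mulr_ge0 (ltW beta_gt0) sq2.
have {}sq1 := mulr_ge0 lb0 sq1.
move: mono sq1 sq2; rewrite !innerE (innerC ip e Dx) (innerC ip Dx V); lra.
Qed.

Lemma potential_nonincreasing c d : 0 <= c -> c <= d -> W d <= W c.
Proof. by move=> c0 cd; have := potential_decay 0 c0 cd; rewrite !inner0r; lra. Qed.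

(* Taking [e := x d - x c] in [potential_decay] stands for bounding the length
   of the path by the integral of its squared speed. *)
Lemma displacement_le c d : 0 <= c -> c <= d -> d - c <= 1 ->
  lambda ^+ 2 * beta * `|x d - x c| ^+ 2 <= W c - W d.
Proof.
move=> c0 cd cd1; have := potential_decay (x d - x c) c0 cd.
have -> : inner ip (x c) (x d - x c) =
    inner ip (x d) (x d - x c) - inner ip (x d - x c) (x d - x c).
  by rewrite !innerE; ring.
rewrite (inner_norm ipn); set n := `|_| ^+ 2; set i := inner _ _ _.
have n0 : 0 <= lambda ^+ 2 * beta * n by rewrite mulr_ge0 ?sqr_ge0// mulr_ge0 ?sqr_ge0// ltW.
have := mulr_ge0 n0 (_ : 0 <= 1 - (d - c)); rewrite subr_ge0 => /(_ cd1).
lra.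
Qed.

(** [2 * lambda * G] absorbs the term [lambda^2 |x'|^2] in the derivative of [|u|^2 / 2], and
    [3 / beta * E] absorbs the [|b|^2] terms, so that [F' <= - |u|^2 / 2]. *)
Definition total t := 2^-1 * inner ip (u t) (u t) + 2 * lambda * G t + 3 / beta * E t.
Local Notation F := total.

Lemma total_decay c d k : 0 <= c -> c <= d ->
  (forall t, c < t < d -> 2 * k <= inner ip (u t) (u t)) ->
  F d + k * (d - c) <= F c.
Proof.
move=> c0 cd ku.
have := @lyapunov 1 (2 * lambda) (3 / beta) k 0 c d c0 cd.
rewrite /lyap !inner0r /F => h; refine ((fun hd => _) (h _)); first by lra.
move=> {h} t Dx Dv ctd + /ode_velocity DvE; rewrite {}DvE.
have t0 : 0 <= t by case/andP: ctd => /ltW ct _; exact: le_trans ct.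
have hu := u_monotone t0; have hb := B_increment_coercive t; have hk := ku t ctd.
move: (u t) (b t) (x t - z) hu hb hk => U V Y hu hb hk mono.
have sq1 : 0 <= inner ip (lambda *: Dx + V) (lambda *: Dx + V).
  by rewrite (inner_norm ipn) sqr_ge0.
have sq2 : 0 <= inner ip (lambda *: Dx + V + U) (lambda *: Dx + V + U).
  by rewrite (inner_norm ipn) sqr_ge0.
have sq3 : 0 <= inner ip V V by rewrite (inner_norm ipn) sqr_ge0.
have sq4 : 0 <= lambda ^+ 2 * inner ip Dx Dx.
  by rewrite (inner_norm ipn) mulr_ge0 ?sqr_ge0.
have {}mono := mulr_ge0 (ltW lambda_gt0) mono.
have b0 : 0 <= 3 / beta by rewrite divr_ge0// ltW.
have hb3 : 3 * inner ip V V <= 3 / beta * inner ip V Y.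
  rewrite -mulrA ler_pM2l// -(ler_pM2l beta_gt0) mulrA divff ?mul1r// gt_eqF//.
have hu3 := mulr_ge0 b0 hu.
have -> : lambda * inner ip Dx Y + inner ip (- (lambda *: Dx + U + V)) Y =
    - inner ip U Y - inner ip V Y.
  by rewrite !innerE; ring.
move: (3 / beta) hb3 hu3 => q hb3 hu3.
move: mono sq1 sq2; rewrite !innerE (innerC ip Dx V) (innerC ip Dx U) (innerC ip V U); lra.
Qed.

Lemma total_ge0 t : 0 <= t -> 0 <= F t.
Proof.
move=> t0; rewrite /total !addr_ge0//.
- by rewrite (inner_norm ipn) mulr_ge0 ?sqr_ge0.
- by rewrite mulr_ge0 ?bregman_ge0// mulr_ge0// ltW.
- by rewrite mulr_ge0 ?energy_ge0// divr_ge0// ltW.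
Qed.

Lemma energy_cvg : exists l : R, E t @[t --> +oo] --> l.
Proof.
apply: nonincreasing_cvg_pinfty energy_ge0 => c d c0 cd.
have := @energy_decay c d 0 c0 cd; rewrite mul0r addr0; apply => t _.
by rewrite (inner_norm ipn) mulr_ge0 ?sqr_ge0// ltW.
Qed.

Lemma potential_cvg : exists l : R, W t @[t --> +oo] --> l.
Proof.
apply: nonincreasing_cvg_pinfty potential_nonincreasing _ => t t0.
by rewrite /W addr_ge0 ?energy_ge0// mulr_ge0 ?bregman_ge0// !mulr_ge0// ltW.
Qed.

Lemma bregman_cvg : exists l : R, G t @[t --> +oo] --> l.
Proof.
have [l El] := energy_cvg; have [m Wm] := potential_cvg.
exists ((2 * lambda * beta)^-1 * (m - l)).
have -> : G = fun t => (2 * lambda * beta)^-1 * (W t - E t).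
  apply/funext => t; rewrite /W addrK mulKf// gt_eqF// !mulr_gt0//.
by apply: cvgM; [exact: cvg_cst|exact: cvgB].
Qed.

(** [|u|^2] is a linear combination of the convergent [F], [G] and [E], and a positive limit would
    drive [F] below 0. *)
Lemma u_norm_cvg0 : `|u t| @[t --> +oo] --> (0 : R).
Proof.
have [l El] := energy_cvg; have [g Gg] := bregman_cvg.
have [f Ff] : exists l : R, F t @[t --> +oo] --> l.
  apply: nonincreasing_cvg_pinfty total_ge0 => c d c0 cd.
  have := @total_decay c d 0 c0 cd; rewrite mul0r addr0; apply => t _.
  by rewrite (inner_norm ipn) mulr0 sqr_ge0.
have Uf : inner ip (u t) (u t) @[t --> +oo] --> 2 * (f - 2 * lambda * g - 3 / beta * l).
  have -> : (fun t => inner ip (u t) (u t)) =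
      (fun t => 2 * (F t - 2 * lambda * G t - 3 / beta * E t)).
    by apply/funext => t; rewrite /total; field; rewrite gt_eqF.
  apply: cvgM; first exact: cvg_cst.
  by apply: cvgB; [apply: cvgB => //|]; apply: cvgM => //; exact: cvg_cst.
move: (2 * (f - _ - _)) Uf => a Ua.
have a0 : a <= 0.
  rewrite leNgt; apply/negP => a0.
  have a40 : 0 < a / 2 by rewrite divr_gt0.
  have [T T0 TP] := cvg_pinfty_ge Ua a40.
  have FT := total_ge0 T0.
  (* After [T], [|u|^2 >= a / 2], so [F] decreases at rate at least [a / 4] and has lost [F T + 1]
     by time [d]. *)
  pose d := T + (F T + 1) / (a / 4).
  have Td : T <= d by rewrite lerDl divr_ge0//; lra.
  have := @total_decay T d (a / 4) T0 Td.
  have -> : a / 4 * (d - T) = F T + 1.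
    by rewrite /d addrAC subrr add0r mulrC divfK// gt_eqF//; lra.
  move=> h; refine ((fun hd => _) (h _)).
    by have := total_ge0 (le_trans T0 Td); lra.
  by move=> t /andP[/ltW Tt _]; have /andP[? _] := TP t Tt; lra.
apply/cvgr0Pnorm_le => e e0.
have e20 : 0 < e ^+ 2 by rewrite exprn_gt0.
have [T T0 TP] := cvg_pinfty_ge Ua e20.
near=> t; rewrite normr_id.
have Tt : T <= t by near: t; apply: nbhs_pinfty_ge; exact: num_real.
have /andP[_] := TP t Tt; rewrite (inner_norm ipn) => h.
have : `|u t| ^+ 2 <= e ^+ 2 by lra.
by rewrite ler_pXn2r ?nnegrE// ltW.
Unshelve. all: by end_near. Qed.

(** If [|b s| > e] at a late time [s], then [|b| >= e / 2] on [[s, s + 1]] because [x] hardly moves,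
    and [E] drops by [beta * e^2 / 4] there, too much for a function close to its limit. *)
Lemma B_cvg : B (x t) @[t --> +oo] --> B z.
Proof.
have [l El] := energy_cvg; have [m Wm] := potential_cvg.
apply/cvgrPdist_le => e e0.
(* Within this distance of its limit [E] can drop by at most [beta * e^2 / 8]. The next bound does
   the same for [W]: by [displacement_le], [x] moves by at most [beta * e / 2], hence [B x] by at
   most [e / 2]. *)
have r0 : 0 < beta * e ^+ 2 / 16 by rewrite divr_gt0// mulr_gt0// exprn_gt0.
have q0 : 0 < lambda ^+ 2 * beta * (beta * e / 2) ^+ 2 / 2.
  by rewrite divr_gt0// !mulr_gt0// ?exprn_gt0// divr_gt0// mulr_gt0.
have [T1 T10 T1P] := cvg_pinfty_ge El r0.
have [T2 T20 T2P] := cvg_pinfty_ge Wm q0.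
near=> s.
have Ts1 : T1 <= s by near: s; apply: nbhs_pinfty_ge; exact: num_real.
have Ts2 : T2 <= s by near: s; apply: nbhs_pinfty_ge; exact: num_real.
rewrite distrC leNgt; apply/negP => es.
have s0 := le_trans T10 Ts1.
have s1 : s <= s + 1 by lra.
have := @energy_decay s (s + 1) (beta * (e / 2) ^+ 2) s0 s1.
have /andP[? ?] := T1P s Ts1; have /andP[? ?] := T1P (s + 1) (le_trans Ts1 s1).
have be2 : 0 < beta * e ^+ 2 by rewrite mulr_gt0// exprn_gt0.
move=> h; refine ((fun hd => _) (h _)); first by lra.
move=> t /andP[st ts1].
have : lambda ^+ 2 * beta * `|x t - x s| ^+ 2 <= lambda ^+ 2 * beta * (beta * e / 2) ^+ 2.
  apply: le_trans (displacement_le s0 (ltW st) _) _; first lra.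
  have /andP[? ?] := T2P s Ts2; have /andP[? ?] := T2P t (le_trans Ts2 (ltW st)); lra.
have be0 : 0 <= beta * e / 2 by rewrite ltW// divr_gt0// mulr_gt0.
rewrite ler_pM2l ?mulr_gt0 ?exprn_gt0// ler_pXn2r ?nnegrE// => xts.
 rewrite ler_pM2l// (inner_norm ipn) ler_pXn2r ?nnegrE//; last by rewrite divr_ge0// ltW.
have := cocoercive_lipschitz ipn beta_gt0 B_coco (x t) (x s).
have : beta^-1 * `|x t - x s| <= e / 2.
  by rewrite -(ler_pM2l beta_gt0) mulrA divff ?mul1r ?gt_eqF// mulrA.
have : `|B (x s) - B z| <= `|b t| + `|B (x t) - B (x s)|.
  by rewrite -(subrKA (B (x t))) addrC (le_trans (ler_normD _ _))// (distrC (B (x s))).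
rewrite /b; lra.
Unshelve. all: by end_near. Qed.

Lemma v_cvg : v t @[t --> +oo] --> - B z.
Proof.
apply/cvgrPdist_le => e e0.
have : \forall t \near pinfty_nbhs R, `| `|u t| | <= e by exact: (cvgr0_norm_le _ u_norm_cvg0).
apply: filterS => t; rewrite normr_id /u -normrN; congr (`|_| <= _).
by rewrite opprD addrC.
Qed.

Lemma x_bounded : exists2 M : R, 0 <= M & forall t, 0 <= t -> `|x t - z| <= M.
Proof.
have M0 : 0 <= 2 / lambda * E 0 by rewrite mulr_ge0 ?energy_ge0// divr_ge0// ltW.
(* A number whose square is at most [K >= 0] is at most [K + 1], which avoids a square root. *)
exists (2 / lambda * E 0 + 1) => [|t t0]; first lra.
have h : E t <= E 0.
  have := @energy_decay 0 t 0 (lexx 0) t0; rewrite mul0r addr0; apply => s _.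
  by rewrite (inner_norm ipn) mulr_ge0 ?sqr_ge0// ltW.
have := le_trans (energy_ge t0) h; rewrite (inner_norm ipn) => hn.
have : `|x t - z| ^+ 2 <= 2 / lambda * E 0.
  rewrite -(ler_pM2l (_ : 0 < lambda / 2)) ?divr_gt0//; apply: le_trans hn _.
  by rewrite mulrA (_ : lambda / 2 * (2 / lambda) = 1) ?mul1r//; field; rewrite gt_eqF.
have := normr_ge0 (x t - z); nra.
Qed.

(** In [lambda / 2 |x - z|^2 = E + G - <u, x - z>] the last term vanishes in the limit, since [u]
    tends to 0 and [x - z] is bounded. *)
Lemma distance_cvg : exists l : R, `|x t - z| ^+ 2 @[t --> +oo] --> l.
Proof.
have [l El] := energy_cvg; have [g Gg] := bregman_cvg.
have [M M0 xM] := x_bounded.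
have uxz : inner ip (u t) (x t - z) @[t --> +oo] --> (0 : R).
  apply/cvgr0Pnorm_le => e e0.
  have e1 : 0 < e / (M + 1) by rewrite divr_gt0//; lra.
  near=> t; apply: le_trans (cauchy_schwarz ipn _ _) _.
  have t0 : 0 <= t by near: t; apply: nbhs_pinfty_ge; exact: num_real.
  have M1 : M + 1 != 0 by rewrite gt_eqF//; lra.
  rewrite -(divfK M1 e) ler_pM//; last by have := xM t t0; lra.
  rewrite -[`|u t|]normr_id; near: t; exact: (cvgr0_norm_le _ u_norm_cvg0).
exists (2 / lambda * (l + g - 0)).
have -> : (fun t => `|x t - z| ^+ 2) =
    (fun t => 2 / lambda * (E t + G t - inner ip (u t) (x t - z))).
  apply/funext => t; rewrite /energy -(inner_norm ipn); field; exact: lt0r_neq0.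
apply: cvgM; first exact: cvg_cst.
by apply: cvgB => //; exact: cvgD.
Unshelve. all: by end_near. Qed.
End Trajectory.

(** * The four limits *)

Unset Implicit Arguments.
Theorem theorem1p8 (R : realType) (H : completeNormedModType R)
    (ip : {dot H for idfun}) (ip_norm : induces_norm ip)
    (Phi : H -> \bar R) (Phi_convex : econvex Phi)
    (Phi_lsc : lower_semicontinuous Phi) (Phi_proper : proper_function Phi)
    (B : H -> H) (beta : R) (beta_gt0 : 0 < beta)
    (B_coco : cocoercive ip beta B)
    (lambda : R) (lambda_gt0 : 0 < lambda)
    (S_neq0 : zeros ip Phi B !=set0)
    (x0 v0 : H) (v0_subdiff : subdifferential ip Phi x0 v0)
    (x v : R -> H)
    (xv_sol : strong_global_solution ip Phi B lambda x0 v0 x v) :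
  [/\ `|v t + B (x t)| @[t --> +oo] --> (0 : R),
      (forall z z' : H, zeros ip Phi B z -> zeros ip Phi B z' -> B z = B z') /\
      (forall z : H, zeros ip Phi B z -> B (x t) @[t --> +oo] --> B z),
      forall z : H, zeros ip Phi B z -> v t @[t --> +oo] --> - B z &
      exists2 xoo : H, zeros ip Phi B xoo & weakly_converges ip x xoo].
Proof.
have Bx z := B_cvg ip_norm Phi_proper beta_gt0 lambda_gt0 B_coco xv_sol (z := z).
have vx z := v_cvg ip_norm Phi_proper beta_gt0 lambda_gt0 B_coco xv_sol (z := z).
have [z zS] := S_neq0.
split => //.
- rewrite -(normr0 H) -(addNr (B z)); apply: cvg_norm; apply: cvgD; [exact: vx|exact: Bx].
- split=> // z1 z2; exact: (zeros_uniq ip_norm Phi_proper beta_gt0 B_coco).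
have [M M0 xM] := x_bounded ip_norm Phi_proper beta_gt0 lambda_gt0 B_coco xv_sol zS.
have x_bnd : \forall t \near pinfty_nbhs R, `|x t| <= M + `|z|.
  near=> t; have t0 : 0 <= t by near: t; apply: nbhs_pinfty_ge; exact: num_real.
  by rewrite -[x t](subrK z) (le_trans (ler_normD _ _))// lerD2r xM.
(* Opial's argument needs convergent distances to the zeros, and that the centers along every finer
   filter [G] be zeros; the limits of [v] and [B x] persist along [G]. *)
have [|G c GP GF cG|c cS cw] := asymptotic_center_weak ip_norm (S := zeros ip Phi B) x_bnd.
- move=> z' z'S; exact: (distance_cvg ip_norm Phi_proper beta_gt0 lambda_gt0 B_coco xv_sol).
- apply: (asymptotic_center_zeros (FF := GP) ip_norm Phi_proper beta_gt0 B_coco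
    Phi_convex Phi_lsc zS (v := v) (GF _ x_bnd) _ _ _ cG).
  + apply: GF; near=> t; apply: (solution_subdiff xv_sol).
    by near: t; apply: nbhs_pinfty_ge; exact: num_real.
  + exact: cvg_trans (cvg_app _ GF) (vx _ zS).
  + exact: cvg_trans (cvg_app _ GF) (Bx _ zS).
by exists c.
Unshelve. all: by end_near. Qed.
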